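(* Assume that $\mu_\beta$ satisfies (G1), (G2) and (G3), and let $\mathcal{K}$ be a set of column indices as in (G3). Then for every solution ($\alpha^k_{jl}$, $h^v_\ell$) of the system $$\begin{cases}\sum_{k=1}^K\alpha^k_{jl}\,h^{v+\mathbf{1}_k}_\ell=h^v_{\ell+\boldsymbol{l}_j}, & J'\in\{0,\dots,J-1\},\ v\in\mathcal{V}[J'],\ \mathcal{J}\subseteq\{1,\dots,J\}\text{ with }|\mathcal{J}|>J',\\ & \ell\in\mathcal{L}^{[\mathcal{J}]},\ j\in\mathcal{J},\ l\in\{1,\dots,L_j\},\\ h^{(0,\dots,0)}_\ell=M_\ell, & \ell\in\mathcal{L}^0,\\ \sum_{v\in\mathcal{V}[J']}C_v\,h^v_{(0,\dots,0)}=1, & J'\in\{0,\dots,J\},\end{cases}$$ one has $\mathrm{Lin}(\alpha^1,\dots,\alpha^K)=\mathrm{Lin}(\bar M[\mathcal{K}])$, where $\alpha^k=(\alpha^k_{jl})_{jl}\in\mathbb{R}^{|L|}$ and $\mathrm{Lin}(\bar M[\mathcal{K}])$ is the linear subspace of $\mathbb{R}^{|L|}$ spanned by the columns of $\bar M[\mathcal{K}]$.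
   Context: Setting: $J\ge1$ and $L=(L_1,\dots,L_J)$ are positive integers, $|L|=\sum_jL_j$; coordinates of $\mathbb{R}^{|L|}$ are indexed by pairs $(j,l)$, $1\le j\le J$, $1\le l\le L_j$. $\mathbb{S}^L=\{\beta\in\mathbb{R}^{|L|}:\beta_{jl}\ge0,\ \sum_l\beta_{jl}=1\text{ for all }j\}$. $\mu_\beta$ is a Borel probability measure on $\mathbb{R}^{|L|}$ with $\mu_\beta(\mathbb{S}^L)=1$. $\beta$ is a random vector with law $\mu_\beta$, and $X=(X_1,\dots,X_J)$ is a random vector, $X_j\in\{1,\dots,L_j\}$, with $\Pr(X_j=l\mid\beta)=\beta_{jl}$. $\mathrm{Lin}$ denotes linear span. (G1): conditionally on $\beta$, $X_1,\dots,X_J$ are mutually independent. (G2): there is a $K$-dimensional linear subspace $Q\subseteq\mathbb{R}^{|L|}$ with $\mu_\beta(Q)=1$ such that no proper linear subspace of $Q$ has $\mu_\beta$-measure $1$. Indices: $\mathcal{L}^0=\{\ell\in\mathbb{Z}^J:0\le\ell_j\le L_j\}$, $\mathcal{L}=\{\ell\in\mathcal{L}^0:\ell_j\ge1\text{ for all }j\}$; for $\mathcal{J}\subseteq\{1,\dots,J\}$, $\mathcal{L}^{[\mathcal{J}]}=\{\ell\in\mathcal{L}^0:\ell_j=0\Leftrightarrow j\in\mathcal{J}\}$. The vector $\boldsymbol{l}_j\in\mathbb{Z}^J$ has $j$-th component $l$ and other components $0$; $\mathbf{1}_k\in\mathbb{Z}^K$ is the $k$-th unit vector. $\mathcal{V}[J']=\{v\in\mathbb{Z}_{\ge0}^K:\sum_kv_k=J'\}$;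 $C_v$ is the number of tuples $(w_1,\dots,w_{J'})\in\{1,\dots,K\}^{J'}$ containing, for every $k$, exactly $v_k$ components equal to $k$. The unknowns of the system are real numbers $\alpha^k_{jl}$ and $h^v_\ell$ ($v\in\mathcal{V}[J']$, $\ell\in\mathcal{L}^{[\mathcal{J}]}$, $J'\le|\mathcal{J}|$). $M_\ell=\int\prod_{j:\ell_j\ne0}\beta_{j\ell_j}\,\mu_\beta(d\beta)$. Moment matrix $M$: an incomplete matrix with rows indexed by pairs $(j,l)$ and columns indexed by $\ell\in\mathcal{L}^0\setminus\mathcal{L}$; the entry in row $(j,l)$, column $\ell$ is $M_{\ell+\boldsymbol{l}_j}$ if $\ell_j=0$, and is unspecified if $\ell_j\ne0$. A completion $\bar M$ of $M$ is a real matrix obtained by filling the unspecified entries with arbitrary real numbers. For a set $\mathcal{K}\subseteq\mathcal{L}^0\setminus\mathcal{L}$, $\bar M[\mathcal{K}]$ is the submatrix of the columns indexed by $\mathcal{K}$. (G3): there exists $\mathcal{K}\subseteq\mathcal{L}^0\setminus\mathcal{L}$ such that (a) for every two completions $\bar M',\bar M''$ of $M$ with $\mathrm{rank}(\bar M')\le K$ and $\mathrm{rank}(\bar M'')\le K$ one has $\bar M'[\mathcal{K}]=\bar M''[\mathcal{K}]$; (b) for any completion $\bar M$ with $\mathrm{rank}(\bar M)\le K$ one has $\mathrm{rank}(\bar M[\mathcal{K}])=K$. Under (G3), $\bar M[\mathcal{K}]$ denotes the common value of this submatrix over all completions $\bar M$ of rank at most $K$. *)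

(* Defs.v *)
From HB Require Import structures.
From mathcomp Require Import all_boot all_order all_algebra.
From mathcomp Require Import all_classical all_reals all_analysis.

Set Implicit Arguments.
Unset Strict Implicit.
Unset Printing Implicit Defensive.

Import Order.TTheory GRing.Theory Num.Theory.
Import numFieldNormedType.Exports.

Local Open Scope classical_set_scope.
Local Open Scope ring_scope.

(** R^{|L|}; the coordinates (j, l) are enumerated by [tagnat.Rank]. *)
Notation vecL R L := 'cV[R]_(\sum_j L j).

Definition borelL (R : realType) (J : nat) (L : 'I_J -> nat) :=
  g_sigma_algebraType (@open (vecL R L)).

(** The coordinate beta_{jl}.  The value l in {1, ..., L_j} is
    represented by the ordinal l - 1 : 'I_(L j). *)
Definition lcoord (R : realType) (J : nat) (L : 'I_J -> nat)
    (b : vecL R L) (j : 'I_J) (l : 'I_(L j)) : R :=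
  b (tagnat.Rank j l) 0.

Definition simplexL (R : realType) (J : nat) (L : 'I_J -> nat) :
    set (borelL R L) :=
  [set b | (forall j (l : 'I_(L j)), 0 <= lcoord b l) /\
           (forall j, \sum_(l < L j) lcoord b l = 1)].

(** [g \o Y] is a version of the conditional probability Pr(A | Y). *)
Definition is_cond_prob (R : realType) (d d' : measure_display)
    (Omega : measurableType d) (T : measurableType d')
    (P : probability Omega R) (Y : {RV P >-> T})
    (A : set Omega) (g : T -> R) : Prop :=
  measurable_fun setT g /\
  forall B : set T, measurable B ->
    P (A `&` Y @^-1` B) = (\int[P]_(w in Y @^-1` B) (g (Y w))%:E)%E.

(** [beta] has law [mu], [mu] is carried by the product of simplices, and
    Pr(X_j = l | beta) = beta_{jl}. *)
Definition mixed_model (R : realType) (J : nat) (L : 'I_J -> nat)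
    (mu : probability (borelL R L) R)
    (d : measure_display) (Omega : measurableType d)
    (P : probability Omega R) (beta : {RV P >-> borelL R L})
    (X : forall j : 'I_J, Omega -> 'I_(L j)) : Prop :=
  [/\ mu (@simplexL R J L) = 1%E,
      forall B : set (borelL R L), measurable B -> distribution P beta B = mu B,
      forall j (l : 'I_(L j)), measurable (X j @^-1` [set l]) &
      forall j (l : 'I_(L j)),
        is_cond_prob beta (X j @^-1` [set l]) (fun b => lcoord b l)].

(** Mutual independence of the X_j conditionally on beta; the choice of the
    versions [g j] of Pr(X_j \in A_j | beta) is immaterial. *)
Definition G1 (R : realType) (J : nat) (L : 'I_J -> nat)
    (d : measure_display) (Omega : measurableType d)
    (P : probability Omega R) (beta : {RV P >-> borelL R L})
    (X : forall j : 'I_J, Omega -> 'I_(L j)) : Prop :=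
  forall (A : forall j : 'I_J, set 'I_(L j)) (g : 'I_J -> borelL R L -> R),
    (forall j, is_cond_prob beta (X j @^-1` A j) (g j)) ->
    is_cond_prob beta [set w | forall j, A j (X j w)]
      (fun b => \prod_(j < J) g j b).

(** [Q] is a minimal linear subspace of full measure, of dimension K. *)
Definition G2 (R : realType) (J : nat) (L : 'I_J -> nat)
    (mu : probability (borelL R L) R) (K : nat) : Prop :=
  exists Q : {vspace vecL R L},
    [/\ \dim Q = K,
        mu [set b | (b : vecL R L) \in Q] = 1%E &
        forall Q' : {vspace vecL R L}, (Q' <= Q)%VS -> Q' <> Q ->
          mu [set b | (b : vecL R L) \in Q'] <> 1%E].

(** The index set L^0.  Here the ordinal ell j is the actual value ell_j, with
    0 standing for "no component"; the level represented by l : 'I_(L j) is the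
    value [lift ord0 l] (i.e. l + 1) of ell_j. *)
Definition idx0 (J : nat) (L : 'I_J -> nat) : finType :=
  {dffun forall j : 'I_J, 'I_(L j).+1}.

Definition idx00 (J : nat) (L : 'I_J -> nat) : idx0 L := [ffun j => ord0].

(** ell + l_j; only meaningful (and only used) when ell_j = 0. *)
Definition add_level (J : nat) (L : 'I_J -> nat) (ell : idx0 L)
    (j : 'I_J) (l : 'I_(L j)) : idx0 L :=
  [ffun i => @dfwith _ (fun i' => 'I_(L i').+1) ell j (lift ord0 l) i].

(** The indices whose zero components are exactly those in JJ. *)
Definition idx_zero_on (J : nat) (L : 'I_J -> nat) (JJ : {set 'I_J}) :
    {set idx0 L} :=
  [set ell : idx0 L | [forall j, (ell j == ord0) == (j \in JJ)]]%SET.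

(** L^0 \ L: the indices with at least one zero component. *)
Definition colidx (J : nat) (L : 'I_J -> nat) : finType :=
  {ell : idx0 L | [exists j, ell j == ord0]}.

Definition moment (R : realType) (J : nat) (L : 'I_J -> nat)
    (mu : probability (borelL R L) R) (ell : idx0 L) : R :=
  \int[mu]_b \prod_(j < J)
    (if unlift ord0 (ell j) is Some l then lcoord (b : vecL R L) l else 1).

Definition is_completion (R : realType) (J : nat) (L : 'I_J -> nat)
    (mu : probability (borelL R L) R)
    (Mb : 'M[R]_(\sum_(j < J) L j, #|colidx L|)) : Prop :=
  forall (ell : colidx L) (j : 'I_J) (l : 'I_(L j)),
    val ell j = ord0 ->
    Mb (tagnat.Rank j l) (enum_rank ell) = moment mu (add_level (val ell) l).

Definition colsel (R : realType) (J : nat) (L : 'I_J -> nat)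
    (KK : {set colidx L}) (Mb : 'M[R]_(\sum_(j < J) L j, #|colidx L|)) :
    'M[R]_(\sum_(j < J) L j, #|KK|) :=
  colsub (fun c : 'I_#|KK| => enum_rank (enum_val c)) Mb.

(** (G3) asserts the existence of a set KK with this property. *)
Definition G3_columns (R : realType) (J : nat) (L : 'I_J -> nat)
    (mu : probability (borelL R L) R) (K : nat) (KK : {set colidx L}) : Prop :=
  (forall M1 M2 : 'M[R]_(\sum_(j < J) L j, #|colidx L|),
     is_completion mu M1 -> is_completion mu M2 ->
     (\rank M1 <= K)%N -> (\rank M2 <= K)%N ->
     colsel KK M1 = colsel KK M2) /\
  (forall Mb : 'M[R]_(\sum_(j < J) L j, #|colidx L|),
     is_completion mu Mb -> (\rank Mb <= K)%N -> \rank (colsel KK Mb) = K).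

(** The common value of [colsel KK Mb] over the completions [Mb] of rank at most
    K (unique by the first half of [G3_columns]; the default value 0 is taken
    only if there is no such completion). *)
Definition Mbar (R : realType) (J : nat) (L : 'I_J -> nat)
    (mu : probability (borelL R L) R) (K : nat) (KK : {set colidx L}) :
    'M[R]_(\sum_(j < J) L j, #|KK|) :=
  xget 0 [set N | exists Mb : 'M[R]_(\sum_(j < J) L j, #|colidx L|),
            [/\ is_completion mu Mb, (\rank Mb <= K)%N & N = colsel KK Mb]].

(** V[J'], a finite set (so that finitely supported sums over it are sums). *)
Definition multiidx (K J' : nat) : set {ffun 'I_K -> nat} :=
  [set v | (\sum_(k < K) v k = J')%N].
Arguments multiidx : clear implicits.

Definition incr (K : nat) (v : {ffun 'I_K -> nat}) (k : 'I_K) :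
    {ffun 'I_K -> nat} := [ffun i => (v i + (i == k))%N].

(** C_v: the words with exactly v_k letters equal to k, for every k. *)
Definition multcount (K : nat) (v : {ffun 'I_K -> nat}) : nat :=
  #|[set w : (\sum_(k < K) v k).-tuple 'I_K |
      [forall k, count_mem k w == v k]]%SET|.

(** [h v ell] is an unknown of the system only when |v| is at most the number of
    zero components of ell; the other values of [h] do not occur below. *)
Definition is_solution (R : realType) (J : nat) (L : 'I_J -> nat)
    (mu : probability (borelL R L) R) (K : nat)
    (alpha : 'I_K -> vecL R L)
    (h : {ffun 'I_K -> nat} -> idx0 L -> R) : Prop :=
  [/\ forall (J' : nat) (v : {ffun 'I_K -> nat}) (JJ : {set 'I_J})
             (ell : idx0 L) (j : 'I_J) (l : 'I_(L j)),
        (J' < J)%N -> multiidx K J' v -> (J' < #|JJ|)%N ->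
        ell \in idx_zero_on L JJ -> j \in JJ ->
        \sum_(k < K) lcoord (alpha k) l * h (incr v k) ell
          = h v (add_level ell l),
      forall ell : idx0 L, h [ffun=> 0%N] ell = moment mu ell &
      forall J' : nat, (J' <= J)%N ->
        \sum_(v \in multiidx K J') (multcount v)%:R * h v (idx00 L) = 1].

(* Main.v *)
Require Import Defs.
From HB Require Import structures.
From mathcomp Require Import all_boot all_order all_algebra.
From mathcomp Require Import all_classical all_reals all_analysis.

Import Order.TTheory GRing.Theory Num.Theory.
Import numFieldNormedType.Exports.

Local Open Scope classical_set_scope.
Local Open Scope ring_scope.

(** The equations of the system with J' = 0 say that the matrix with columns
    [\sum_k h^{1_k}_ell alpha^k] is a completion of the moment matrix: they give
    the entries M_{ell + l_j} wherever these are specified.  It factors through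
    R^K, so it has rank at most K, and (G3) applies to it: its columns indexed by
    KK are those of Mbar, and they have rank K.  By construction they lie
    in Lin(alpha^1, ..., alpha^K), whose dimension is at most K, so the two spans
    coincide. *)

(** Every column is a combination of the [\dim] basis vectors of the column
    span, hence the matrix factors through a space of that dimension. *)
Lemma rank_le_dim_span_col {F : fieldType} {m n : nat} (B : 'M[F]_(m, n)) :
  (\rank B <= \dim <<[seq col c B | c : 'I_n]>>%VS)%N.
Proof.
set S := <<_>>%VS.
pose V : 'M[F]_(m, \dim S) := \matrix_(i, k) (vbasis S)`_k i 0.
pose C : 'M[F]_(\dim S, n) := \matrix_(k, c) coord (vbasis S) k (col c B).
suff -> : B = V *m C by apply: leq_trans (mulmx_max_rank _ _) _.
apply/matrixP => i c.
have cS : col c B \in S by apply/memv_span/map_f; rewrite mem_enum.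
have /matrixP/(_ i 0) := coord_vbasis cS.
rewrite !mxE summxE => ->; apply: eq_bigr => k _.
by rewrite !mxE mulrC.
Qed.

(** Dimension count: K vectors span a space of dimension at most K, while the
    columns of a matrix of rank K span one of dimension at least K. *)
Lemma span_eq_span_col {F : fieldType} {m n K : nat} (B : 'M[F]_(m, n))
    (a : 'I_K -> 'cV[F]_m) :
    (forall c, col c B \in <<[seq a k | k : 'I_K]>>%VS) -> \rank B = K ->
  <<[seq a k | k : 'I_K]>>%VS = <<[seq col c B | c : 'I_n]>>%VS.
Proof.
move=> sub_a rankB; apply/esym/eqP; rewrite eqEdim; apply/andP; split.
  by apply/span_subvP => _ /mapP [c _ ->].
apply: leq_trans (rank_le_dim_span_col B).
by rewrite rankB (leq_trans (dim_span _)) // size_map size_enum_ord.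
Qed.

(** Column ell is [\sum_k h^{1_k}_ell alpha^k]; writing the matrix as a product
    exhibits its factorization through R^K. *)
Definition solution_completion {R : realType} {J : nat} {L : 'I_J -> nat}
    {K : nat} (alpha : 'I_K -> vecL R L)
    (h : {ffun 'I_K -> nat} -> idx0 L -> R) :
    'M[R]_(\sum_(j < J) L j, #|colidx L|) :=
  (\matrix_(i, k) alpha k i 0) *m
  (\matrix_(k, c) h (incr [ffun=> 0%N] k) (val (enum_val c))).

Lemma rank_solution_completion {R : realType} {J : nat} {L : 'I_J -> nat}
    {K : nat} (alpha : 'I_K -> vecL R L)
    (h : {ffun 'I_K -> nat} -> idx0 L -> R) :
  (\rank (solution_completion alpha h) <= K)%N.
Proof. exact: mulmx_max_rank. Qed.

Lemma col_solution_completion {R : realType} {J : nat} {L : 'I_J -> nat}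
    {K : nat} (alpha : 'I_K -> vecL R L)
    (h : {ffun 'I_K -> nat} -> idx0 L -> R) (c : 'I_#|colidx L|) :
  col c (solution_completion alpha h) \in <<[seq alpha k | k : 'I_K]>>%VS.
Proof.
have -> : col c (solution_completion alpha h)
    = \sum_k h (incr [ffun=> 0%N] k) (val (enum_val c)) *: alpha k.
  apply/colP => i; rewrite !mxE summxE; apply: eq_bigr => k _.
  by rewrite !mxE mulrC.
by apply: memv_suml => k _; apply/memvZ/memv_span/map_f; rewrite mem_enum.
Qed.

(** The case v = 0 of the first family of equations, taken with JJ the set of
    zero components of ell, combined with h^0 = M. *)
Lemma is_completion_solution {R : realType} {J : nat} {L : 'I_J -> nat}
    {K : nat} {mu : probability (borelL R L) R} {alpha : 'I_K -> vecL R L}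
    {h : {ffun 'I_K -> nat} -> idx0 L -> R} :
  is_solution mu alpha h -> is_completion mu (solution_completion alpha h).
Proof.
move=> [eq_h h0 _] ell j l ellj0.
pose JJ : {set 'I_J} := [set i | val ell i == ord0]%SET.
have jJJ : j \in JJ by rewrite inE ellj0.
rewrite -h0 -(eq_h 0%N _ JJ _ _ _ (leq_ltn_trans (leq0n j) (ltn_ord j))) //.
- by rewrite mxE; apply: eq_bigr => k _; rewrite !mxE enum_rankK.
- by rewrite /multiidx /= big1 // => k _; rewrite ffunE.
- by rewrite card_gt0; apply/set0Pn; exists j.
- by rewrite inE; apply/forallP => i; rewrite inE.
Qed.

Lemma Mbar_eq {R : realType} {J : nat} {L : 'I_J -> nat} {K : nat}
    {mu : probability (borelL R L) R} {KK : {set colidx L}}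
    {Mb : 'M[R]_(\sum_(j < J) L j, #|colidx L|)} :
    G3_columns mu K KK -> is_completion mu Mb -> (\rank Mb <= K)%N ->
  Mbar mu K KK = colsel KK Mb.
Proof.
move=> [uniq_KK _] cMb rMb; rewrite /Mbar; apply: xget_unique.
  by exists Mb.
by move=> _ [M' [cM' rM' ->]]; apply: uniq_KK.
Qed.

Theorem theorem7p5 (R : realType) (J : nat) (L : 'I_J -> nat) (K : nat)
    (hJ : (0 < J)%N) (hL : forall j, (0 < L j)%N)
    (mu : probability (borelL R L) R)
    (d : measure_display) (Omega : measurableType d)
    (P : probability Omega R) (beta : {RV P >-> borelL R L})
    (X : forall j : 'I_J, Omega -> 'I_(L j))
    (hmodel : mixed_model mu beta X)
    (hG1 : G1 beta X)
    (hG2 : G2 mu K)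
    (KK : {set colidx L}) (hG3 : G3_columns mu K KK)
    (alpha : 'I_K -> vecL R L) (h : {ffun 'I_K -> nat} -> idx0 L -> R)
    (hsol : is_solution mu alpha h) :
  <<[seq alpha k | k : 'I_K]>>%VS
    = <<[seq (col c (Mbar mu K KK) : vecL R L) | c : 'I_#|KK|]>>%VS.
Proof.
have cMb := is_completion_solution hsol.
have rMb := rank_solution_completion alpha h.
rewrite (Mbar_eq hG3 cMb rMb); apply: span_eq_span_col => [c|].
  by rewrite /colsel col_colsub; apply: col_solution_completion.
by case: hG3 => _; apply.
Qed.
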